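(* Let $\angle A,\angle B,\angle C,\alpha,\beta,\gamma$ be six positive numbers with $\angle A+\angle B+\angle C=\pi$, $\alpha+\beta+\gamma<2\pi$, $\alpha<\beta+\gamma$, $\beta<\gamma+\alpha$ and $\gamma<\alpha+\beta$. The spherical question and the solid question defined in the context are equivalent in that both depend only on the numbers $\angle A,\angle B,\angle C,\alpha,\beta,\gamma$, and the answers to these two questions are the same. Thus the following two assertions are equivalent too: (1) if $\angle A,\angle B,\angle C$ do not exceed $\pi/2$, then the spherical question is answered in the affirmative; (2) if $\angle A,\angle B,\angle C$ do not exceed $\pi/2$, then the solid question is answered in the affirmative.
   Context: The symbols $\angle A,\angle B,\angle C$ denote given positive numbers (angles in radians). Spherical question. Let $\mathscr{C}_1,\mathscr{C}_2,\mathscr{C}_3$ be any three great circles on the unit sphere with three arcs, one from each circle, forming a spherical triangle with side lengths $\alpha,\beta,\gamma$, where the arc of length $\alpha$ (resp. $\beta$, $\gamma$) lies on $\mathscr{C}_1$ (resp. $\mathscr{C}_2$, $\mathscr{C}_3$). For another great circle $\mathscr{C}$ (other than $\mathscr{C}_1,\mathscr{C}_2,\mathscr{C}_3$), let $p_j$ and $p'_j$ denote the intersection points of $\mathscr{C}$ and $\mathscr{C}_j$ ($j=1,2,3$), labeled so that, moving around $\mathscr{C}$ in one of the two directions, the six intersection points occur in the cyclic order $p_1,p_2,p_3,p'_1,p'_2,p'_3$. Does there exist such a great circle $\mathscr{C}$ along which the arcs from $p_1$ to $p_2$, from $p_2$ to $p_3$, and from $p_3$ to $p'_1$ have lengths $\angle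 C$, $\angle A$ and $\angle B$, respectively? Solid question. Let $\ell_1,\ell_2,\ell_3$ be three lines in $\mathbb{R}^3$ passing through the origin, with $\alpha$ and $\pi-\alpha$ being the angles between $\ell_2$ and $\ell_3$, $\beta$ and $\pi-\beta$ being the angles between $\ell_3$ and $\ell_1$, and $\gamma$ and $\pi-\gamma$ being the angles between $\ell_1$ and $\ell_2$; the three planes determined by these lines taken pairwise meet the unit sphere in three great circles $\mathscr{C}_1$ (from $\ell_2,\ell_3$), $\mathscr{C}_2$ (from $\ell_3,\ell_1$), $\mathscr{C}_3$ (from $\ell_1,\ell_2$), and these are great circles as in the setup of the spherical question. Consider three distinct points $A,B,C$ with $A$ on $\ell_1$, $B$ on $\ell_2$ and $C$ on $\ell_3$. Can $A,B,C$ be selected so that the interior angles of $\triangle ABC$ at $A$, $B$ and $C$ are $\angle A$, $\angle B$ and $\angle C$, respectively?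
   Formalization: In the solid question the points A, B, C are also required to differ from the origin; otherwise three mutually perpendicular lines with ∠A = π/2, ∠B = ∠C = π/4 have a positive solid answer (A at the origin) but a negative spherical one. *)

(* Defs.v *)
From HB Require Import structures.
From mathcomp Require Import all_boot all_order all_algebra.
From mathcomp Require Import boolp classical_sets reals trigo.

Set Implicit Arguments.
Unset Strict Implicit.
Unset Printing Implicit Defensive.

Import Order.TTheory GRing.Theory Num.Theory.

Local Open Scope classical_set_scope.
Local Open Scope ring_scope.

(* Euclidean structure; the library's norm on matrices is the sup norm. *)
Definition dot (R : realType) (u v : 'rV[R]_3) : R :=
  \sum_(i < 3) u 0 i * v 0 i.

Definition enorm (R : realType) (u : 'rV[R]_3) : R := Num.sqrt (dot u u).

(* Meaningful for nonzero u and v only; the value is then in [0, pi]. *)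
Definition vangle (R : realType) (u v : 'rV[R]_3) : R :=
  acos (dot u v / (enorm u * enorm v)).

Definition interior_angle (R : realType) (P Q S : 'rV[R]_3) : R :=
  vangle (Q - P) (S - P).

Definition unit_sphere (R : realType) : set 'rV[R]_3 :=
  [set p | enorm p = 1].

(* Trace on the unit sphere of a linear subspace. *)
Definition sphere_trace (R : realType) (P : {vspace 'rV[R]_3}) : set 'rV[R]_3 :=
  [set` P] `&` @unit_sphere R.

Definition great_circle (R : realType) (C : set 'rV[R]_3) : Prop :=
  exists P : {vspace 'rV[R]_3}, \dim P = 2%N /\ C = sphere_trace P.

(* c runs around the great circle C at unit speed, with period 2 pi; replacing
   v by - v reverses the direction of motion. *)
Definition arclength_param (R : realType) (C : set 'rV[R]_3)
    (c : R -> 'rV[R]_3) : Prop :=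
  exists u v : 'rV[R]_3,
    [/\ enorm u = 1, enorm v = 1, dot u v = 0,
        (forall t, c t = cos t *: u + sin t *: v) & range c = C].

(* The arc is c @` `[t, t + L]. *)
Definition joined_by_arc (R : realType) (C : set 'rV[R]_3)
    (p q : 'rV[R]_3) (L : R) : Prop :=
  0 < L < 2 * pi /\
  exists c t, [/\ arclength_param C c, c t = p & c (t + L) = q].

(* V1, V2, V3 are the vertices of the triangle. Under the strict inequalities
   assumed on the side lengths in the theorem, the sides are shorter than pi
   and the three circles are automatically distinct and not concurrent. *)
Definition spherical_setup (R : realType) (alpha beta gamma : R)
    (C1 C2 C3 : set 'rV[R]_3) : Prop :=
  [/\ great_circle C1, great_circle C2, great_circle C3 &
      exists V1 V2 V3 : 'rV[R]_3,
        [/\ joined_by_arc C1 V2 V3 alpha,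
            joined_by_arc C2 V3 V1 beta &
            joined_by_arc C3 V1 V2 gamma]].

(* Moving along c from p1 at time t1, one meets p1, p2, p3, p1', p2', p3' in
   this order within one turn; c may follow C in either direction. *)
Definition cuts_prescribed_arcs (R : realType) (angA angB angC : R)
    (C1 C2 C3 C : set 'rV[R]_3) : Prop :=
  exists p1 p2 p3 p1' p2' p3' : 'rV[R]_3,
    [/\ C `&` C1 = [set p1; p1'],
        C `&` C2 = [set p2; p2'],
        C `&` C3 = [set p3; p3'] &
        exists (c : R -> 'rV[R]_3) (t1 t2 t3 t1' t2' t3' : R),
          [/\ arclength_param C c,
              [/\ t1 < t2, t2 < t3 & t3 < t1'] /\
              [/\ t1' < t2', t2' < t3' & t3' < t1 + 2 * pi],
              [/\ c t1 = p1, c t2 = p2 & c t3 = p3],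
              [/\ c t1' = p1', c t2' = p2' & c t3' = p3'] &
              [/\ t2 - t1 = angC, t3 - t2 = angA & t1' - t3 = angB]]].

Definition spherical_yes (R : realType) (angA angB angC : R)
    (C1 C2 C3 : set 'rV[R]_3) : Prop :=
  exists C : set 'rV[R]_3,
    [/\ great_circle C, C <> C1, C <> C2, C <> C3 &
        cuts_prescribed_arcs angA angB angC C1 C2 C3 C].

(* Two supplementary values, one for each relative orientation. *)
Definition line_angles (R : realType) (l m : {vspace 'rV[R]_3}) : set R :=
  [set theta | exists u v : 'rV[R]_3,
     [/\ u \in l, v \in m, u != 0, v != 0 & theta = vangle u v]].

(* The angles alone do not determine the lines up to isometry (one of alpha,
   beta, gamma could be traded for its supplement); the last condition does. *)
Definition solid_setup (R : realType) (alpha beta gamma : R)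
    (l1 l2 l3 : {vspace 'rV[R]_3}) : Prop :=
  [/\ [/\ \dim l1 = 1%N, \dim l2 = 1%N & \dim l3 = 1%N],
      line_angles l2 l3 = [set alpha; pi - alpha],
      line_angles l3 l1 = [set beta; pi - beta],
      line_angles l1 l2 = [set gamma; pi - gamma] &
      spherical_setup alpha beta gamma
        (sphere_trace (l2 + l3)) (sphere_trace (l3 + l1))
        (sphere_trace (l1 + l2))].

(* The origin, common to the three lines, is not accepted as a vertex: with it,
   three pairwise orthogonal lines and angA = pi / 2 would admit the triangles
   with A = 0, B on l2 and C on l3, in the plane of l2 and l3, although no great
   circle other than C1, C2, C3 has the arcs required. *)
Definition solid_yes (R : realType) (angA angB angC : R)
    (l1 l2 l3 : {vspace 'rV[R]_3}) : Prop :=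
  exists A B C : 'rV[R]_3,
    [/\ [/\ A \in l1, B \in l2 & C \in l3],
        [/\ A != 0, B != 0 & C != 0],
        [/\ A != B, B != C & C != A] &
        [/\ interior_angle A B C = angA,
            interior_angle B C A = angB &
            interior_angle C A B = angC]].

(* Main.v *)
(* Choose unit vectors V1, V2, V3 at the vertices of the spherical triangle;
   their Gram matrix is given by the cosines of alpha, beta, gamma and is
   nonsingular. Both questions are equivalent to the existence of nonzero
   a, b, c such that the triangle A = a V1, B = b V2, C = c V3 has the prescribed
   angles, and this depends on the Gram matrix only. For the spherical question,
   the circle is the trace of the plane through the origin parallel to ABC, and
   p1, p2, p3 are the directions of B - C, A - C, A - B, with
     sin angA p1 - sin angB p2 + sin angC p3 = 0.
   That this circle differs from C1, C2, C3 amounts to a, b, c being nonzero. *)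

Require Import Defs.
From HB Require Import structures.
From mathcomp Require Import all_boot all_order all_algebra.
From mathcomp Require Import boolp classical_sets reals trigo.
From mathcomp Require Import ring lra.

Import Order.TTheory GRing.Theory Num.Theory.

Local Open Scope classical_set_scope.
Local Open Scope ring_scope.

(** * Euclidean inner product, norm and angles *)

Lemma dotC {R : realType} (u v : 'rV[R]_3) : dot u v = dot v u.
Proof. by apply: eq_bigr => i _; rewrite mulrC. Qed.

Lemma dotDl {R : realType} (u v w : 'rV[R]_3) :
  dot (u + v) w = dot u w + dot v w.
Proof. by rewrite -big_split; apply: eq_bigr => i _; rewrite !mxE mulrDl. Qed.

Lemma dotZl {R : realType} (a : R) (u w : 'rV[R]_3) :
  dot (a *: u) w = a * dot u w.
Proof. by rewrite mulr_sumr; apply: eq_bigr => i _; rewrite !mxE mulrA. Qed.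

Lemma dotDr {R : realType} (u v w : 'rV[R]_3) :
  dot w (u + v) = dot w u + dot w v.
Proof. by rewrite dotC dotDl !(dotC w). Qed.

Lemma dotZr {R : realType} (a : R) (u w : 'rV[R]_3) :
  dot w (a *: u) = a * dot w u.
Proof. by rewrite dotC dotZl (dotC w). Qed.

Lemma dotNl {R : realType} (u w : 'rV[R]_3) : dot (- u) w = - dot u w.
Proof. by rewrite -scaleN1r dotZl mulN1r. Qed.

Lemma dotNr {R : realType} (u w : 'rV[R]_3) : dot w (- u) = - dot w u.
Proof. by rewrite dotC dotNl dotC. Qed.

Lemma dot0l {R : realType} (w : 'rV[R]_3) : dot 0 w = 0.
Proof. by rewrite -(scale0r w) dotZl mul0r. Qed.

Definition dotE :=
  (@dotDl, @dotDr, @dotZl, @dotZr, @dotNl, @dotNr).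

Lemma dotvv_ge0 {R : realType} (u : 'rV[R]_3) : 0 <= dot u u.
Proof. by apply: sumr_ge0 => i _; rewrite -expr2 sqr_ge0. Qed.

Lemma dotvv_eq0 {R : realType} (u : 'rV[R]_3) : (dot u u == 0) = (u == 0).
Proof.
apply/eqP/eqP => [u0|->]; last by rewrite dot0l.
apply/rowP => i; rewrite mxE; apply/eqP; rewrite -sqrf_eq0 expr2.
by move/eqP: u0; rewrite psumr_eq0 => [/allP/(_ i)|j _];
  rewrite ?mem_index_enum /= -?expr2 ?sqr_ge0 // => ->.
Qed.

Lemma enorm_sqr {R : realType} (u : 'rV[R]_3) : enorm u ^+ 2 = dot u u.
Proof. by rewrite sqr_sqrtr // dotvv_ge0. Qed.

Lemma enormZ {R : realType} (a : R) (u : 'rV[R]_3) :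
  enorm (a *: u) = `|a| * enorm u.
Proof.
by rewrite /enorm dotZl dotZr mulrA -expr2 sqrtrM ?sqr_ge0 // sqrtr_sqr.
Qed.

Lemma enormN {R : realType} (u : 'rV[R]_3) : enorm (- u) = enorm u.
Proof. by rewrite -scaleN1r enormZ normrN1 mul1r. Qed.

Lemma enorm_gt0 {R : realType} (u : 'rV[R]_3) : (0 < enorm u) = (u != 0).
Proof. by rewrite sqrtr_gt0 lt0r dotvv_eq0 dotvv_ge0 andbT. Qed.

Lemma enorm_eq1 {R : realType} (u : 'rV[R]_3) : enorm u = 1 <-> dot u u = 1.
Proof.
split=> [u1|u1]; first by rewrite -enorm_sqr u1 expr1n.
by rewrite /enorm u1 sqrtr1.
Qed.

Lemma enorm1_neq0 {R : realType} (u : 'rV[R]_3) : enorm u = 1 -> u != 0.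
Proof. by move=> u1; rewrite -enorm_gt0 u1 ltr01. Qed.

(** Both bounds come from expanding the squared norms of [u + v] and [u - v]; they put the inner
    product in the domain where [cos] undoes [acos]. *)
Lemma dot_unit_itv {R : realType} (u v : 'rV[R]_3) :
  dot u u = 1 -> dot v v = 1 -> -1 <= dot u v <= 1.
Proof.
move=> u1 v1; have := dotvv_ge0 (u + v); have := dotvv_ge0 (u - v).
by rewrite !dotE u1 v1 (dotC v u) => ? ?; apply/andP; split; lra.
Qed.

Lemma enorm_normalize {R : realType} (u : 'rV[R]_3) :
  u != 0 -> enorm ((enorm u)^-1 *: u) = 1.
Proof.
rewrite -enorm_gt0 => u0.
by rewrite enormZ ger0_norm ?invr_ge0 ?ltW // mulVf // gt_eqF.
Qed.

Lemma vangle_normalize {R : realType} (u v : 'rV[R]_3) :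
  vangle u v = acos (dot ((enorm u)^-1 *: u) ((enorm v)^-1 *: v)).
Proof. by rewrite /vangle dotZl dotZr invfM mulrC mulrA. Qed.

Lemma cos_vangle {R : realType} (u v : 'rV[R]_3) : u != 0 -> v != 0 ->
  cos (vangle u v) = dot ((enorm u)^-1 *: u) ((enorm v)^-1 *: v).
Proof.
move=> u0 v0; rewrite vangle_normalize acosK // in_itv /=.
by apply: dot_unit_itv; apply/enorm_eq1/enorm_normalize.
Qed.

Lemma vangle_scaled {R : realType} (a b t : R) (p q : 'rV[R]_3) :
  0 < a -> 0 < b -> enorm p = 1 -> enorm q = 1 ->
  0 <= t <= pi -> dot p q = cos t -> vangle (a *: p) (b *: q) = t.
Proof.
move=> a0 b0 p1 q1 t_itv pq.
rewrite /vangle !enormZ p1 q1 !gtr0_norm // !mulr1 dotZl dotZr pq.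
by rewrite mulrA mulrC mulKf ?cosK ?mulf_neq0 ?gt_eqF // in_itv.
Qed.

(** Serves to transport a triangle from one configuration to another with the same inner products,
    without constructing an isometry of space. *)
Lemma interior_angle_isometric {R : realType} (P Q S P' Q' S' : 'rV[R]_3) :
  [/\ dot (Q - P) (Q - P) = dot (Q' - P') (Q' - P'),
      dot (S - P) (S - P) = dot (S' - P') (S' - P') &
      dot (Q - P) (S - P) = dot (Q' - P') (S' - P')] ->
  interior_angle P Q S = interior_angle P' Q' S'.
Proof. by case=> q s qs; rewrite /interior_angle /vangle /enorm q s qs. Qed.

(** * Planes through the origin and unit-speed great circles *)

Lemma add_vlineP {R : realType} (x p q : 'rV[R]_3) :
  x \in (<[p]> + <[q]>)%VS <-> exists a b : R, x = a *: p + b *: q.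
Proof.
split=> [/memv_addP[_ /vlineP[a ->] [_ /vlineP[b ->] ->]]|[a [b ->]]].
  by exists a, b.
by rewrite memv_add // memvZ // memv_line.
Qed.

Lemma vlineZ {R : realType} (a : R) (p : 'rV[R]_3) :
  a != 0 -> (<[a *: p]> = <[p]>)%VS.
Proof.
move=> a0; apply: subv_anti; rewrite -!memvE memvZ ?memv_line //=.
by rewrite -{1}[p](scalerK a0) memvZ ?memv_line.
Qed.

Lemma add_vline_eq {R : realType} (u v p q : 'rV[R]_3) :
  p \in (<[u]> + <[v]>)%VS -> q \in (<[u]> + <[v]>)%VS ->
  u \in (<[p]> + <[q]>)%VS -> v \in (<[p]> + <[q]>)%VS ->
  (<[u]> + <[v]> = <[p]> + <[q]>)%VS.
Proof.
move=> pU qU uP vP; apply: subv_anti.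
by rewrite !subv_add -!memvE pU qU uP vP.
Qed.

(** [acos x] has the right cosine, and its sine is [|y|]; a negative [y] is reached by negating the
    parameter. *)
Lemma cos_sin_exists {R : realType} (x y : R) :
  x ^+ 2 + y ^+ 2 = 1 -> exists t, cos t = x /\ sin t = y.
Proof.
move=> xy1; have x_itv : -1 <= x <= 1.
  rewrite -ler_norml -(@ler_pXn2r _ 2) ?nnegrE // real_normK ?num_real //.
  by rewrite expr1n -xy1 lerDl sqr_ge0.
have xK : cos (acos x) = x by rewrite acosK // in_itv.
have yE : sin (acos x) = `|y|.
  by rewrite sin_acos // -xy1 addrAC subrr add0r sqrtr_sqr.
have [y0|y0] := leP 0 y.
  by exists (acos x); rewrite xK yE ger0_norm.
by exists (- acos x); rewrite cosN sinN xK yE ltr0_norm // opprK.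
Qed.

Lemma range_param {R : realType} (u v : 'rV[R]_3) :
  enorm u = 1 -> enorm v = 1 -> dot u v = 0 ->
  range (fun t => cos t *: u + sin t *: v) = sphere_trace (<[u]> + <[v]>)%VS.
Proof.
move=> /enorm_eq1 u1 /enorm_eq1 v1 uv; apply/seteqP.
have nE a b : dot (a *: u + b *: v) (a *: u + b *: v) = a ^+ 2 + b ^+ 2.
  by rewrite !dotE (dotC v) u1 v1 uv; ring.
split=> [_ [t _ <-]|x [/= /add_vlineP[a [b ->]] /enorm_eq1]].
  split; first by apply/add_vlineP; exists (cos t), (sin t).
  by apply/enorm_eq1; rewrite nE cos2Dsin2.
by rewrite nE => /cos_sin_exists[t [<- <-]]; exists t.
Qed.

Lemma dot_param {R : realType} (C : set 'rV[R]_3) c (t t' : R) :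
  arclength_param C c -> dot (c t) (c t') = cos (t' - t).
Proof.
case=> u [v [/enorm_eq1 u1 /enorm_eq1 v1 uv cE _]].
by rewrite !cE !dotE (dotC v) u1 v1 uv cosB; ring.
Qed.

Lemma enorm_param {R : realType} (C : set 'rV[R]_3) c (t : R) :
  arclength_param C c -> enorm (c t) = 1.
Proof. by move=> cC; apply/enorm_eq1; rewrite (dot_param _ _ _ _ cC) subrr cos0. Qed.

(** Three vectors of a plane are dependent, and the coefficients are the 2 by 2 determinants of
    their coordinates, here sines of differences. This is where the law of sines enters. *)
Lemma param_relation {R : realType} (C : set 'rV[R]_3) c (t1 t2 t3 : R) :
  arclength_param C c ->
  sin (t3 - t2) *: c t1 + sin (t1 - t3) *: c t2 + sin (t2 - t1) *: c t3 = 0.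
Proof.
case=> u [v [_ _ _ cE _]]; apply/rowP => i.
by rewrite !cE !mxE !sinB; ring.
Qed.

Lemma paramDpi {R : realType} (C : set 'rV[R]_3) c (t : R) :
  arclength_param C c -> c (t + pi) = - c t.
Proof.
case=> u [v [_ _ _ cE _]].
by rewrite !cE cosDpi sinDpi !scaleNr opprD.
Qed.

Lemma param_trace {R : realType} (C : set 'rV[R]_3) c (t t' : R) :
  arclength_param C c -> sin (t' - t) != 0 ->
  C = sphere_trace (<[c t]> + <[c t']>)%VS.
Proof.
case=> u [v [u1 v1 uv cE cC]] s0.
have -> : C = sphere_trace (<[u]> + <[v]>)%VS.
  by rewrite -cC (funext cE) range_param.
rewrite !cE; congr sphere_trace; apply: add_vline_eq; apply/add_vlineP.
- by exists (cos t), (sin t).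
- by exists (cos t'), (sin t').
(* [sin (t' - t)] is the determinant of the coordinates of [c t] and [c t'] in the basis [u], [v];
   Cramer's rule expresses [u] and [v] back. *)
- exists (sin t' / sin (t' - t)), (- sin t / sin (t' - t)).
  by apply/rowP => i; rewrite !mxE; move: s0; rewrite sinB => ?; field.
exists (- cos t' / sin (t' - t)), (cos t / sin (t' - t)).
by apply/rowP => i; rewrite !mxE; move: s0; rewrite sinB => ?; field.
Qed.

Lemma trace_param {R : realType} (p q : 'rV[R]_3) (L : R) :
  0 < L < pi -> enorm p = 1 -> enorm q = 1 -> dot p q = cos L ->
  exists c, [/\ arclength_param (sphere_trace (<[p]> + <[q]>)%VS) c,
                c 0 = p & c L = q].
Proof.
move=> /sin_gt0_pi sL p1 q1 pq; have sL0 : sin L != 0 by rewrite gt_eqF.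
(* Gram-Schmidt: the component of [q] orthogonal to [p] has length [sin L]. *)
pose v := (sin L)^-1 *: (q - cos L *: p).
move/enorm_eq1: (p1) => p1'; move/enorm_eq1: (q1) => q1'.
have pv : dot p v = 0 by rewrite /v !dotE pq p1'; ring.
have v1 : enorm v = 1.
  apply/enorm_eq1; rewrite /v !dotE q1' p1' (dotC q) pq.
  transitivity ((1 - cos L ^+ 2) / sin L ^+ 2); first by field.
  by rewrite -sin2cos2 divff // sqrf_eq0.
pose c t := cos t *: p + sin t *: v.
have c0 : c 0 = p by rewrite /c cos0 sin0 scale0r scale1r addr0.
have cL : c L = q.
  by rewrite /c /v scalerA divff // scale1r addrC subrK.
exists c; split=> //; exists p, v; split=> //.
have cP : arclength_param (sphere_trace (<[p]> + <[v]>)%VS) c.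
  by exists p, v; split=> //; rewrite range_param.
rewrite range_param // (param_trace _ _ 0 L cP) ?subr0 //.
by rewrite c0 cL.
Qed.

(** The difference [c s - x] lies in the plane of the circle and is orthogonal to two vectors
    spanning it, hence to itself. *)
Lemma param_eq {R : realType} (C : set 'rV[R]_3) c (t t' s : R) (x : 'rV[R]_3) :
  arclength_param C c -> x \in (<[c t]> + <[c t']>)%VS ->
  sin (t' - t) != 0 ->
  dot (c t) x = cos (s - t) -> dot (c t') x = cos (s - t') -> c s = x.
Proof.
move=> cC xP s0 xt xt'.
have : c s - x \in (<[c t]> + <[c t']>)%VS.
  rewrite memvB //.
  suff [] : sphere_trace (<[c t]> + <[c t']>)%VS (c s) by [].
  rewrite -(param_trace _ _ _ _ cC s0).
  by case: (cC) => u [v [_ _ _ _ <-]]; exists s.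
move=> /add_vlineP[a [b wE]]; apply/eqP; rewrite -subr_eq0 -dotvv_eq0.
by rewrite {1}wE !dotE xt xt' !(dot_param _ _ _ _ cC) !subrr !mulr0 addr0.
Qed.

Lemma great_circle_param {R : realType} (C : set 'rV[R]_3) c :
  arclength_param C c -> great_circle C.
Proof.
case=> u [v [u1 v1 uv cE <-]]; exists (<[u]> + <[v]>)%VS; split.
  rewrite dimv_disjoint_sum ?dim_vline ?enorm1_neq0 //.
  apply/eqP; rewrite -subv0; apply/subvP => x.
  rewrite memv_cap memv0 => /andP[/vlineP[a ->] /vlineP[b auE]].
  by rewrite -dotvv_eq0 {2}auE !dotE uv !mulr0.
by rewrite (funext cE) range_param.
Qed.

(** An arc shorter than [pi] has independent endpoints, so these determine its circle; the arc is
    thereby traded for inner products. *)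
Lemma joined_by_arc_short {R : realType} (C : set 'rV[R]_3) p q (L : R) :
  0 < L < pi ->
  joined_by_arc C p q L <->
  [/\ enorm p = 1, enorm q = 1, dot p q = cos L &
      C = sphere_trace (<[p]> + <[q]>)%VS].
Proof.
move=> L_itv; split=> [[_ [c [t [cC <- <-]]]]|[p1 q1 pq ->]].
  have tL : t + L - t = L by ring.
  split; rewrite ?(enorm_param _ _ _ cC) //.
    by rewrite (dot_param _ _ _ _ cC) tL.
  by apply: param_trace cC _; rewrite tL gt_eqF // sin_gt0_pi.
split; first by have := pi_gt0 R; move: L_itv => /andP[? ?] ?; apply/andP; split; lra.
have [c [cC c0 cL]] := trace_param _ _ _ L_itv p1 q1 pq.
by exists c, 0; rewrite add0r.
Qed.

(** As [q] is off [W], a vector of [U] lying in [W] has no [q] component; only the two unit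
    multiples of [p] remain. *)
Lemma trace_meet {R : realType} (U W : {vspace 'rV[R]_3}) (p q : 'rV[R]_3) :
  U = (<[p]> + <[q]>)%VS -> enorm p = 1 -> p \in W -> q \notin W ->
  sphere_trace U `&` sphere_trace W = [set p; - p].
Proof.
move=> -> p1 pW qW.
have pU : p \in (<[p]> + <[q]>)%VS by rewrite memvE addvSl.
apply/seteqP; split=> [x [[/= /add_vlineP[a [b xE]] x1] [/= xW _]]|x].
  have b0 : b = 0.
    apply: contraNeq qW => b0.
    rewrite -[q](scalerK b0) memvZ //.
    have -> : b *: q = x - a *: p by rewrite xE addrC addKr.
    by rewrite memvB // memvZ.
  move: x1; rewrite /unit_sphere /= xE b0 scale0r addr0 enormZ p1 mulr1.
  case: ger0P => _; first by move=> ->; left; rewrite scale1r.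
  by move/eqP; rewrite eqr_oppLR => /eqP ->; right; rewrite scaleN1r.
by case=> ->; split; split; rewrite /unit_sphere /= ?rpredN ?enormN.
Qed.

(** * Vertex vectors, their Gram matrix and linear independence *)

Definition frame {R : realType} (alpha beta gamma : R)
    (V1 V2 V3 : 'rV[R]_3) : Prop :=
  [/\ enorm V1 = 1, enorm V2 = 1, enorm V3 = 1 &
      [/\ dot V2 V3 = cos alpha, dot V3 V1 = cos beta &
          dot V1 V2 = cos gamma]].

Definition lin_indep3 {R : realType} (V1 V2 V3 : 'rV[R]_3) : Prop :=
  forall x y z : R, x *: V1 + y *: V2 + z *: V3 = 0 -> [/\ x = 0, y = 0 & z = 0].

(** The common form of both questions. The scalars may be negative, since a line extends to both
    sides of the origin. *)
Definition frame_triangle {R : realType} (angA angB angC : R)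
    (V1 V2 V3 : 'rV[R]_3) : Prop :=
  exists a b c : R,
    [/\ a != 0, b != 0, c != 0 &
        [/\ interior_angle (a *: V1) (b *: V2) (c *: V3) = angA,
            interior_angle (b *: V2) (c *: V3) (a *: V1) = angB &
            interior_angle (c *: V3) (a *: V1) (b *: V2) = angC]].

(** The same scalars serve both frames: inner products of edges are polynomials in [a], [b], [c] and
    the Gram entries. *)
Lemma frame_triangle_isometric {R : realType}
    (angA angB angC alpha beta gamma : R) (V1 V2 V3 W1 W2 W3 : 'rV[R]_3) :
  frame alpha beta gamma V1 V2 V3 -> frame alpha beta gamma W1 W2 W3 ->
  frame_triangle angA angB angC V1 V2 V3 ->
  frame_triangle angA angB angC W1 W2 W3.
Proof.
case=> /enorm_eq1 v1 /enorm_eq1 v2 /enorm_eq1 v3 [v23 v31 v12].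
case=> /enorm_eq1 w1 /enorm_eq1 w2 /enorm_eq1 w3 [w23 w31 w12].
case=> a [b [c [a0 b0 c0 [<- <- <-]]]]; exists a, b, c.
split=> //; split; apply: interior_angle_isometric; rewrite !dotE;
  by rewrite !(dotC V2 V1, dotC V3 V2, dotC V1 V3) !(dotC W2 W1, dotC W3 W2,
     dotC W1 W3) v1 v2 v3 v23 v31 v12 w1 w2 w3 w23 w31 w12.
Qed.

(* The Gram determinant factors as
   (cos (beta - gamma) - cos alpha) * (cos alpha - cos (beta + gamma)). *)
Lemma gram_det_gt0 {R : realType} (alpha beta gamma : R) :
  0 < alpha -> 0 < beta -> 0 < gamma -> alpha + beta + gamma < 2 * pi ->
  alpha < beta + gamma -> beta < gamma + alpha -> gamma < alpha + beta ->
  0 < 1 + 2 * cos alpha * cos beta * cos gamma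
      - cos alpha ^+ 2 - cos beta ^+ 2 - cos gamma ^+ 2.
Proof.
move=> a0 b0 g0 s2 ha hb hg.
have -> : 1 + 2 * cos alpha * cos beta * cos gamma
    - cos alpha ^+ 2 - cos beta ^+ 2 - cos gamma ^+ 2 =
    (cos (beta - gamma) - cos alpha) * (cos alpha - cos (beta + gamma)).
  rewrite cosB cosD.
  have := sin2cos2 beta; have := sin2cos2 gamma => sg sb.
  (* By the addition formulas the two factors are [sin beta * sin gamma] plus and minus the same
     quantity, so their product is a difference of squares. *)
  transitivity (sin beta ^+ 2 * sin gamma ^+ 2 -
    (cos alpha - cos beta * cos gamma) ^+ 2); last by ring.
  by rewrite sg sb; ring.
have cos_norm x : cos `|x : R| = cos x.
  by case: ger0P => // _; rewrite cosN.
have cos_lt x y : 0 <= x -> x < y -> y <= pi -> cos y < cos x :> R.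
  by move=> x0 xy yp; rewrite ltr_cos // in_itv /=; apply/andP; split; lra.
apply: mulr_gt0; rewrite subr_gt0.
  (* Two of the triangle inequalities say that [|beta - gamma| < alpha]; the absolute value brings
     the argument into the range where [cos] decreases. *)
  rewrite -(cos_norm (_ - _)); apply: cos_lt; rewrite ?normr_ge0 ?ltr_norml //; last lra.
  by apply/andP; split; lra.
have [h|h] := leP (beta + gamma) pi; first by apply: cos_lt => //; lra.
(* Past [pi] the sum is reflected to [2 * pi - (beta + gamma)], which exceeds [alpha] by the bound
   on the perimeter. *)
have -> : cos (beta + gamma) = cos (2 * pi - (beta + gamma)).
  by rewrite -cosN -[LHS]cosD2pi; congr cos; ring.
by apply: cos_lt; lra.
Qed.

(** Pairing a vanishing combination with each vector gives a homogeneous system whose matrix is the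
    Gram matrix, of positive determinant [D]. *)
Lemma frame_lin_indep {R : realType} (alpha beta gamma : R)
    (V1 V2 V3 : 'rV[R]_3) :
  0 < alpha -> 0 < beta -> 0 < gamma -> alpha + beta + gamma < 2 * pi ->
  alpha < beta + gamma -> beta < gamma + alpha -> gamma < alpha + beta ->
  frame alpha beta gamma V1 V2 V3 -> lin_indep3 V1 V2 V3.
Proof.
move=> a0 b0 g0 s2 ha hb hg.
case=> /enorm_eq1 v1 /enorm_eq1 v2 /enorm_eq1 v3 [v23 v31 v12] x y z xyz.
have := gram_det_gt0 _ _ _ a0 b0 g0 s2 ha hb hg.
set D := (X in 0 < X) => /lt0r_neq0 D0.
have e1 : x + y * cos gamma + z * cos beta = 0.
  by rewrite -(dot0l V1) -xyz !dotE v1 v31 (dotC V2) v12; ring.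
have e2 : x * cos gamma + y + z * cos alpha = 0.
  by rewrite -(dot0l V2) -xyz !dotE v2 v12 (dotC V3) v23; ring.
have e3 : x * cos beta + y * cos alpha + z = 0.
  by rewrite -(dot0l V3) -xyz !dotE v3 v23 (dotC V1) v31; ring.
(* Cramer's rule *)
split; apply: (mulIf D0); rewrite mul0r.
- transitivity ((1 - cos alpha ^+ 2) * (x + y * cos gamma + z * cos beta)
    + (cos alpha * cos beta - cos gamma) * (x * cos gamma + y + z * cos alpha)
    + (cos alpha * cos gamma - cos beta) * (x * cos beta + y * cos alpha + z)).
    by rewrite /D; ring.
  by rewrite e1 e2 e3; ring.
- transitivity ((cos alpha * cos beta - cos gamma)
      * (x + y * cos gamma + z * cos beta)
    + (1 - cos beta ^+ 2) * (x * cos gamma + y + z * cos alpha)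
    + (cos beta * cos gamma - cos alpha) * (x * cos beta + y * cos alpha + z)).
    by rewrite /D; ring.
  by rewrite e1 e2 e3; ring.
transitivity ((cos alpha * cos gamma - cos beta)
    * (x + y * cos gamma + z * cos beta)
  + (cos beta * cos gamma - cos alpha) * (x * cos gamma + y + z * cos alpha)
  + (1 - cos gamma ^+ 2) * (x * cos beta + y * cos alpha + z)).
  by rewrite /D; ring.
by rewrite e1 e2 e3; ring.
Qed.

Lemma lin_indep3_rot {R : realType} (V1 V2 V3 : 'rV[R]_3) :
  lin_indep3 V1 V2 V3 -> lin_indep3 V2 V3 V1.
Proof.
by move=> h x y z; rewrite addrC addrA => /h[].
Qed.

(** Applied to an edge of the triangle that joins the line of [V1] to the opposite plane; it keeps
    the new circle apart from the three given ones. *)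
Lemma lin_indep3_notin {R : realType} (a : R) (V1 V2 V3 w : 'rV[R]_3) :
  lin_indep3 V1 V2 V3 -> a != 0 -> w \in (<[V2]> + <[V3]>)%VS ->
  a *: V1 - w \notin (<[V2]> + <[V3]>)%VS.
Proof.
move=> indep a0 wP; apply: contra_neqN a0 => dP.
have : a *: V1 \in (<[V2]> + <[V3]>)%VS by rewrite -(subrK w (a *: V1)) memvD.
case/add_vlineP=> x [y aE].
have [] // := indep a (- x) (- y) _.
by rewrite aE -addrA addrACA !scaleNr !subrr addr0.
Qed.

Lemma lin_indep3_sub_neq0 {R : realType} (a b : R) (V1 V2 V3 : 'rV[R]_3) :
  lin_indep3 V1 V2 V3 -> a != 0 -> a *: V1 - b *: V2 != 0.
Proof.
move=> indep a0; apply: contra_neq a0 => abE.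
have [] // := indep a (- b) 0 _.
by rewrite scale0r addr0 scaleNr.
Qed.

(** * The spherical question in terms of triangles on a frame *)

Lemma spherical_setup_frame {R : realType} (alpha beta gamma : R)
    (C1 C2 C3 : set 'rV[R]_3) :
  0 < alpha < pi -> 0 < beta < pi -> 0 < gamma < pi ->
  spherical_setup alpha beta gamma C1 C2 C3 ->
  exists V1 V2 V3, [/\ frame alpha beta gamma V1 V2 V3,
    C1 = sphere_trace (<[V2]> + <[V3]>)%VS,
    C2 = sphere_trace (<[V3]> + <[V1]>)%VS &
    C3 = sphere_trace (<[V1]> + <[V2]>)%VS].
Proof.
move=> a_itv b_itv g_itv [_ _ _ [V1 [V2 [V3 [J1 J2 J3]]]]].
have [v2 v3 v23 C1E] := (joined_by_arc_short _ _ _ _ a_itv).1 J1.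
have [_ v1 v31 C2E] := (joined_by_arc_short _ _ _ _ b_itv).1 J2.
have [_ _ v12 C3E] := (joined_by_arc_short _ _ _ _ g_itv).1 J3.
by exists V1, V2, V3.
Qed.

(** For excluding zero scalars: a degenerate triangle would make [C] one of the three given circles.
    Here [a] and [b] are nonzero because points of [C] are unit vectors. *)
Lemma param_scaled_trace {R : realType} (C : set 'rV[R]_3) c (t t' a b : R) p q :
  arclength_param C c -> sin (t' - t) != 0 -> c t = a *: p -> c t' = b *: q ->
  C = sphere_trace (<[p]> + <[q]>)%VS.
Proof.
move=> cC s0 tE t'E; rewrite (param_trace _ _ _ _ cC s0) tE t'E.
have k0 s k (x : 'rV[R]_3) : c s = k *: x -> k != 0.
  move=> sE; have := enorm1_neq0 _ (enorm_param _ _ s cC).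
  by rewrite sE scaler_eq0 negb_or => /andP[].
by rewrite !vlineZ ?(k0 _ _ _ tE) ?(k0 _ _ _ t'E).
Qed.

(** The relation between [p1], [p2], [p3] makes the vectors [sin angA *: p1], [sin angB *: p2],
    [sin angC *: p3] close up into a triangle. Each lies in one coordinate plane of the basis [V1],
    [V2], [V3], so the triangle can be placed with its vertices on the axes. *)
Lemma spherical_yes_triangle {R : realType} (angA angB angC : R)
    (V1 V2 V3 : 'rV[R]_3) :
  0 < angA -> 0 < angB -> 0 < angC -> angA + angB + angC = pi ->
  lin_indep3 V1 V2 V3 ->
  spherical_yes angA angB angC (sphere_trace (<[V2]> + <[V3]>)%VS)
    (sphere_trace (<[V3]> + <[V1]>)%VS) (sphere_trace (<[V1]> + <[V2]>)%VS) ->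
  frame_triangle angA angB angC V1 V2 V3.
Proof.
move=> A0 B0 C0 sumpi indep [C [_ CC1 CC2 CC3]].
case=> p1 [p2 [p3 [p1' [p2' [p3' [I1 I2 I3]]]]]].
case=> c [t1 [t2 [t3 [t1' [_ [_ [cC _ [c1 c2 c3] _]]]]]]] [d12 d23 d31].
have sA : 0 < sin angA by apply: sin_gt0_pi; apply/andP; split; lra.
have sB : 0 < sin angB by apply: sin_gt0_pi; apply/andP; split; lra.
have sC : 0 < sin angC by apply: sin_gt0_pi; apply/andP; split; lra.
have sinpi x : sin (pi - x) = sin x :> R.
  by rewrite addrC sinDpi sinN opprK.
have d13 : t3 - t1 = pi - angB by rewrite -sumpi -d12 -d23; ring.
have dots : [/\ dot p2 p3 = cos angA, dot p1 p3 = - cos angB & dot p1 p2 = cos angC].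
  rewrite -c1 -c2 -c3 !(dot_param _ _ _ _ cC) d12 d23 d13; split=> //.
  by rewrite addrC cosDpi cosN.
have mem1 C' p p' : C `&` C' = [set p; p'] -> C' p.
  by move=> I; have [] : (C `&` C') p by rewrite I; left.
have [/add_vlineP[x2 [x3 p1E]] p1_1] := mem1 _ _ _ I1.
have [/add_vlineP[y3 [y1 p2E]] p2_1] := mem1 _ _ _ I2.
have [/add_vlineP[z1 [z2 p3E]] p3_1] := mem1 _ _ _ I3.
have rel : sin angA *: p1 - sin angB *: p2 + sin angC *: p3 = 0.
  have := param_relation _ _ t1 t2 t3 cC.
  rewrite -(opprB t3) sinN d12 d23 d13 sinpi c1 c2 c3.
  by rewrite scaleNr.
(* These are the coefficients of [V1], [V2], [V3] in the relation [rel]. *)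
have [ca cb cc] : [/\ - (sin angB * y1) + sin angC * z1 = 0,
    sin angA * x2 + sin angC * z2 = 0 & sin angA * x3 - sin angB * y3 = 0].
  apply: indep; rewrite -rel p1E p2E p3E; apply/rowP => i; rewrite !mxE; ring.
have {}ca : sin angB * y1 = sin angC * z1 by lra.
have {}cb : sin angC * z2 = - (sin angA * x2) by lra.
have {}cc : sin angB * y3 = sin angA * x3 by lra.
(* Read off from the requirements [A - B = sin angC *: p3] and [B - C = sin angA *: p1]; the second
   one explains the minus sign. *)
exists (sin angC * z1), (sin angA * x2), (- (sin angA * x3)).
have AB : (sin angC * z1) *: V1 - (sin angA * x2) *: V2 = sin angC *: p3.
  by rewrite p3E scalerDr !scalerA cb scaleNr.
have BC : (sin angA * x2) *: V2 - (- (sin angA * x3)) *: V3 = sin angA *: p1.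
  by rewrite p1E scalerDr !scalerA -scaleNr opprK.
have AC : (sin angC * z1) *: V1 - (- (sin angA * x3)) *: V3 = sin angB *: p2.
  by rewrite p2E scalerDr !scalerA -scaleNr opprK addrC ca cc.
have eq0 k x : 0 < k -> k * x = 0 -> x = 0 :> R.
  by move=> k0 /eqP; rewrite mulf_eq0 gt_eqF //= => /eqP.
split.
(* If [a] vanished, [p2] and [p3] would lie on the lines of [V3] and [V2], forcing [C] to be the
   first circle. The other two cases are cyclic. *)
- apply/eqP => a0; apply: CC1.
  have z10 := eq0 _ _ sC a0; have y10 : y1 = 0 by apply: eq0 sB _; rewrite ca.
  rewrite addvC; apply: (param_scaled_trace _ c t2 t3 y3 z2 _ _ cC).
  + by rewrite d23 gt_eqF.
  + by rewrite c2 p2E y10 scale0r addr0.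
  + by rewrite c3 p3E z10 scale0r add0r.
- apply/eqP => b0; apply: CC2.
  have x20 := eq0 _ _ sA b0.
  have z20 : z2 = 0 by apply: eq0 sC _; rewrite cb b0 oppr0.
  apply: (param_scaled_trace _ c t1 t3 x3 z1 _ _ cC).
  + by rewrite d13 sinpi gt_eqF.
  + by rewrite c1 p1E x20 scale0r add0r.
  + by rewrite c3 p3E z20 scale0r addr0.
- rewrite oppr_eq0; apply/eqP => c0; apply: CC3.
  have x30 := eq0 _ _ sA c0; have y30 : y3 = 0 by apply: eq0 sB _; rewrite cc.
  rewrite addvC; apply: (param_scaled_trace _ c t1 t2 x2 y1 _ _ cC).
  + by rewrite d12 gt_eqF.
  + by rewrite c1 p1E x30 scale0r addr0.
  + by rewrite c2 p2E y30 scale0r add0r.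
have [d1 d2 d3] := dots.
have p1_1' : enorm (- p1) = 1 by rewrite enormN.
have p2_1' : enorm (- p2) = 1 by rewrite enormN.
have p3_1' : enorm (- p3) = 1 by rewrite enormN.
rewrite /interior_angle; split.
(* At [A] both edges are reversed and the signs cancel; at [B] only one is, which offsets the sign
   in [dot p1 p3 = - cos angB]; at [C] none is. *)
- rewrite -opprB AB -(opprB (_ *: V1)) AC -!scalerN.
  apply: vangle_scaled => //; first by apply/andP; split; lra.
  by rewrite dotNl dotNr opprK dotC.
- rewrite -opprB BC AB -scalerN.
  apply: vangle_scaled => //; first by apply/andP; split; lra.
  by rewrite dotNl d2 opprK.
- rewrite AC BC.
  apply: vangle_scaled => //; first by apply/andP; split; lra.
  by rewrite dotC.
Qed.

(** The circle is run from the direction of [B - C] at time [0] towards that of [A - C] at time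
    [angC]. The direction of [A - B] then has to come at time [angC + angA], as its inner products
    with the first two show. *)
Lemma triangle_spherical_yes {R : realType} (angA angB angC : R)
    (V1 V2 V3 : 'rV[R]_3) :
  0 < angA -> 0 < angB -> 0 < angC -> angA + angB + angC = pi ->
  lin_indep3 V1 V2 V3 ->
  frame_triangle angA angB angC V1 V2 V3 ->
  spherical_yes angA angB angC (sphere_trace (<[V2]> + <[V3]>)%VS)
    (sphere_trace (<[V3]> + <[V1]>)%VS) (sphere_trace (<[V1]> + <[V2]>)%VS).
Proof.
move=> A0 B0 C0 sumpi indep [a [b [c [a0 b0 c0]]]].
set A := a *: V1; set B := b *: V2; set C := c *: V3; case=> hA hB hC.
have indep2 := lin_indep3_rot _ _ _ indep.
have indep3 := lin_indep3_rot _ _ _ indep2.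
have BC0 : B - C != 0 by apply: lin_indep3_sub_neq0 indep2 b0.
have AC0 : A - C != 0 by rewrite -oppr_eq0 opprB; apply: lin_indep3_sub_neq0 indep3 c0.
have AB0 : A - B != 0 by apply: lin_indep3_sub_neq0 indep a0.
pose n (x : 'rV[R]_3) := (enorm x)^-1 *: x.
have nN x : n (- x) = - n x by rewrite /n enormN scalerN.
have dA : dot (n (A - C)) (n (A - B)) = cos angA.
  rewrite -hA cos_vangle -?(opprB A) ?oppr_eq0 //.
  by rewrite -!/(n _) !nN dotNl dotNr opprK dotC.
have dB : dot (n (B - C)) (n (A - B)) = - cos angB.
  rewrite -hB cos_vangle -?(opprB B C) ?oppr_eq0 //.
  by rewrite -!/(n _) nN dotNl opprK.
have dC : dot (n (B - C)) (n (A - C)) = cos angC.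
  by rewrite -hC cos_vangle // dotC.
have sC : sin angC != 0 by rewrite gt_eqF // sin_gt0_pi //; apply/andP; split; lra.
have nK x : x != 0 -> x = enorm x *: n x.
  by move=> x0; rewrite scalerA divff ?scale1r // gt_eqF // enorm_gt0.
have n1 x : x != 0 -> enorm (n x) = 1 by exact: enorm_normalize.
have n0 x : x != 0 -> (enorm x)^-1 != 0.
  by rewrite -enorm_gt0 => x0; rewrite invr_eq0 gt_eqF.
have angC_itv : 0 < angC < pi by apply/andP; split; lra.
have [f [fP f0 fC]] :=
  trace_param _ _ _ angC_itv (n1 _ BC0) (n1 _ AC0) dC.
have fCA : f (angC + angA) = n (A - B).
  apply: (param_eq _ _ 0 angC _ _ fP); rewrite ?f0 ?fC ?subr0 //.
  (* The coefficients express [A - B = (A - C) - (B - C)] after normalization. *)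
  - apply/add_vlineP; exists (- ((enorm (A - B))^-1 * enorm (B - C))),
      ((enorm (A - B))^-1 * enorm (A - C)).
    rewrite scaleNr [RHS]addrC -!scalerA -!nK // -scalerBr; congr (_ *: _).
    by rewrite opprB addrA subrK.
  - rewrite dB (_ : _ + _ = - angB + pi) ?cosDpi ?cosN //.
    by rewrite -sumpi; ring.
  - by rewrite dA addrAC subrr add0r.
have nW (W : {vspace 'rV[R]_3}) x : x != 0 -> x \notin W -> n x \notin W.
  by move=> x0; apply: contra => nxW; rewrite (nK _ x0) memvZ.
have memB k l (X Y : 'rV[R]_3) : n (k *: X - l *: Y) \in (<[X]> + <[Y]>)%VS.
  by apply: memvZ; apply/add_vlineP; exists k, (- l); rewrite scaleNr.
have memr k (X Y : 'rV[R]_3) : k *: Y \in (<[X]> + <[Y]>)%VS.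
  by apply/add_vlineP; exists 0, k; rewrite scale0r add0r.
have meml k (X Y : 'rV[R]_3) : k *: X \in (<[X]> + <[Y]>)%VS.
  by rewrite addvC memr.
have p2W : n (A - C) \notin (<[V2]> + <[V3]>)%VS.
  by apply: nW => //; apply: lin_indep3_notin => //; exact: memr.
have p3W : n (A - B) \notin (<[V3]> + <[V1]>)%VS.
  rewrite -(opprB B) nN rpredN nW //; first by rewrite -oppr_eq0 opprB.
  by apply: lin_indep3_notin => //; exact: memr.
have p1W : n (B - C) \notin (<[V1]> + <[V2]>)%VS.
  rewrite -(opprB C) nN rpredN nW //; first by rewrite -oppr_eq0 opprB.
  by apply: lin_indep3_notin => //; exact: memr.
set K := sphere_trace _ in fP.
have Kf t : K (f t) by case: fP => u [v [_ _ _ _ <-]]; exists t.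
have notin_trace (W : {vspace 'rV[R]_3}) x : K x -> x \notin W -> K <> sphere_trace W.
  by move=> Kx xW KW; move: Kx xW; rewrite KW => -[/= ->].
have sA : sin angA != 0 by rewrite gt_eqF // sin_gt0_pi //; apply/andP; split; lra.
have sCA : sin (angC + angA) != 0.
  by rewrite gt_eqF // sin_gt0_pi //; apply/andP; split; lra.
(* Any two of the three directions span the plane. To apply [trace_meet] to each given circle, the
   pair is rotated so that its first member is on that circle and its second is off it. *)
have K23 : K = sphere_trace (<[n (A - C)]> + <[n (A - B)]>)%VS.
  rewrite -fC -fCA; apply: param_trace fP _.
  by rewrite addrAC subrr add0r.
have K31 : K = sphere_trace (<[n (A - B)]> + <[n (B - C)]>)%VS.
  by rewrite addvC -f0 -fCA; apply: param_trace fP _; rewrite subr0.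
exists K; split.
- exact: great_circle_param fP.
- by apply: notin_trace p2W; rewrite -fC; exact: Kf.
- by apply: notin_trace p3W; rewrite -fCA; exact: Kf.
- by apply: notin_trace p1W; rewrite -f0; exact: Kf.
exists (n (B - C)), (n (A - C)), (n (A - B)), (- n (B - C)), (- n (A - C)),
  (- n (A - B)).
split.
- by apply: trace_meet p2W; rewrite ?n1 //; exact: memB.
- by rewrite K23; apply: trace_meet p3W; rewrite ?n1 // addvC; exact: memB.
- by rewrite K31; apply: trace_meet p1W; rewrite ?n1 //; exact: memB.
(* Antipodes come half a turn later. The order holds since [angC + angA < pi], and the gap before
   [0 + pi] is [angB]. *)
exists f, 0, angC, (angC + angA), (0 + pi), (angC + pi), (angC + angA + pi).
by split; rewrite ?(paramDpi _ _ _ fP) ?f0 ?fC ?fCA //; split=> //; try split; lra.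
Qed.

(** * The solid question in terms of triangles on a frame *)

(** Every nonzero vector of a subspace is a multiple of a unit vector in it, so the trace recovers
    the subspace. *)
Lemma sphere_trace_inj {R : realType} :
  injective (@sphere_trace R).
Proof.
suff sub (U W : {vspace 'rV[R]_3}) :
    sphere_trace U = sphere_trace W -> (U <= W)%VS.
  by move=> U W UW; apply: subv_anti; rewrite !sub.
move=> UW; apply/subvP => x xU.
have [->|x0] := eqVneq x 0; first exact: mem0v.
have [xW _] : sphere_trace W ((enorm x)^-1 *: x).
  by rewrite -UW; split; [exact: memvZ | exact: enorm_normalize].
have n0 : (enorm x)^-1 != 0 by rewrite invr_eq0 gt_eqF ?enorm_gt0.
by rewrite -[x](scalerK n0); apply: memvZ.
Qed.

Lemma line_of_two_planes {R : realType} (X Y Z : 'rV[R]_3)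
    (l : {vspace 'rV[R]_3}) :
  lin_indep3 X Y Z -> \dim l = 1%N ->
  (l <= <[X]> + <[Y]>)%VS -> (l <= <[Y]> + <[Z]>)%VS -> l = <[Y]>%VS.
Proof.
move=> indep dl lXY lYZ; apply/eqP.
rewrite eqEdim dl dim_vline leq_b1 andbT; apply/subvP => w wl.
have /add_vlineP[a [b wE]] := subvP lXY _ wl.
have /add_vlineP[d [e wE']] := subvP lYZ _ wl.
have [a0 _ _] : [/\ a = 0, b - d = 0 & - e = 0].
  apply: indep; transitivity (w - w); last by rewrite subrr.
  by rewrite {1}wE wE'; apply/rowP => i; rewrite !mxE; ring.
by rewrite wE a0 scale0r add0r memvZ ?memv_line.
Qed.

(** The spherical triangle contained in the set-up supplies the vertices. Equal traces give equal
    planes, and each line is then the intersection of two of the planes. *)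
Lemma solid_setup_frame {R : realType} (alpha beta gamma : R)
    (l1 l2 l3 : {vspace 'rV[R]_3}) :
  0 < alpha -> 0 < beta -> 0 < gamma -> alpha + beta + gamma < 2 * pi ->
  alpha < beta + gamma -> beta < gamma + alpha -> gamma < alpha + beta ->
  solid_setup alpha beta gamma l1 l2 l3 ->
  exists V1 V2 V3, [/\ frame alpha beta gamma V1 V2 V3,
    l1 = <[V1]>%VS, l2 = <[V2]>%VS & l3 = <[V3]>%VS].
Proof.
move=> a0 b0 g0 s2 ha hb hg [[d1 d2 d3] _ _ _].
case/spherical_setup_frame; try by apply/andP; split; lra.
move=> V1 [V2 [V3 [fV /sphere_trace_inj E1 /sphere_trace_inj E2]]].
move=> /sphere_trace_inj E3.
have indep1 := frame_lin_indep _ _ _ _ _ _ a0 b0 g0 s2 ha hb hg fV.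
have indep2 := lin_indep3_rot _ _ _ indep1.
have indep3 := lin_indep3_rot _ _ _ indep2.
exists V1, V2, V3; split=> //.
- by apply: line_of_two_planes indep3 d1 _ _; rewrite -?E2 -?E3 ?addvSl ?addvSr.
- by apply: line_of_two_planes indep1 d2 _ _; rewrite -?E1 -?E3 ?addvSl ?addvSr.
- by apply: line_of_two_planes indep2 d3 _ _; rewrite -?E1 -?E2 ?addvSl ?addvSr.
Qed.

(** A point on a line is a multiple of its vertex vector; independence makes points with nonzero
    scalars distinct. *)
Lemma solid_yes_triangle {R : realType} (angA angB angC : R)
    (V1 V2 V3 : 'rV[R]_3) :
  lin_indep3 V1 V2 V3 ->
  solid_yes angA angB angC <[V1]>%VS <[V2]>%VS <[V3]>%VS <->
  frame_triangle angA angB angC V1 V2 V3.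
Proof.
move=> indep1; have indep2 := lin_indep3_rot _ _ _ indep1.
have indep3 := lin_indep3_rot _ _ _ indep2.
have neq0 k (X : 'rV[R]_3) : k *: X != 0 -> k != 0.
  by rewrite scaler_eq0 negb_or => /andP[].
split=> [[_ [_ [_ [[/vlineP[a ->] /vlineP[b ->] /vlineP[c ->]] n0 _ angles]]]]|].
  by case: n0 => /neq0 a0 /neq0 b0 /neq0 c0; exists a, b, c.
have neqs k m (X Y Z : 'rV[R]_3) : lin_indep3 X Y Z -> k != 0 ->
    k *: X != m *: Y /\ k *: X != 0.
  move=> indep k0; have sub0 j := lin_indep3_sub_neq0 _ j _ _ _ indep k0.
  split; first by move: (sub0 m); rewrite subr_eq0.
  by move: (sub0 0); rewrite scale0r subr0.
case=> a [b [c [a0 b0 c0 angles]]]; exists (a *: V1), (b *: V2), (c *: V3).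
have [? ?] := neqs a b _ _ _ indep1 a0.
have [? ?] := neqs b c _ _ _ indep2 b0.
have [? ?] := neqs c a _ _ _ indep3 c0.
by split=> //; split; rewrite ?memvZ ?memv_line.
Qed.

(** Only the signs of the two scalars matter: equal signs give [t], opposite signs give [pi - t]. *)
Lemma line_angles_vline {R : realType} (p q : 'rV[R]_3) (t : R) :
  enorm p = 1 -> enorm q = 1 -> 0 <= t <= pi -> dot p q = cos t ->
  line_angles <[p]>%VS <[q]>%VS = [set t; pi - t].
Proof.
move=> p1 q1 t_itv pq.
have t'_itv : 0 <= pi - t <= pi by move: t_itv => /andP[? ?]; apply/andP; split; lra.
have cospi : cos (pi - t) = - cos t by rewrite addrC cosDpi cosN.
have p1' : enorm (- p) = 1 by rewrite enormN.
have q1' : enorm (- q) = 1 by rewrite enormN.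
have p0 := enorm1_neq0 _ p1; have q0 := enorm1_neq0 _ q1.
apply/seteqP; split=> [_ [_ [_ [/vlineP[x ->] /vlineP[y ->] + + ->]]]|s].
  rewrite !scaler_eq0 !negb_or (negbTE p0) (negbTE q0) !andbT => x0 y0 /=.
  have [x_lt|x_gt|/eqP] := ltgtP x 0; last by rewrite (negbTE x0).
    rewrite -[x *: p]opprK -scaleNr -scalerN.
    have [y_lt|y_gt|/eqP] := ltgtP y 0; last by rewrite (negbTE y0).
      left; rewrite -[y *: q]opprK -scaleNr -scalerN.
      by apply: vangle_scaled; rewrite ?oppr_gt0 // dotNl dotNr opprK.
    by right; apply: vangle_scaled; rewrite ?oppr_gt0 // dotNl pq cospi.
  have [y_lt|y_gt|/eqP] := ltgtP y 0; last by rewrite (negbTE y0).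
    right; rewrite -[y *: q]opprK -scaleNr -scalerN.
    by apply: vangle_scaled; rewrite ?oppr_gt0 // dotNr pq cospi.
  by left; apply: vangle_scaled.
case=> ->; [exists p, q | exists p, (- q)]; split;
  rewrite ?rpredN ?memv_line ?oppr_eq0 //.
  by rewrite -[p]scale1r -[q]scale1r (vangle_scaled _ _ t).
by rewrite -[p]scale1r -[- q]scale1r (vangle_scaled _ _ (pi - t)) // dotNr pq cospi.
Qed.

(** Turns a spherical set-up into a solid one by drawing lines through the vertices, so that
    assertion (2) can be applied in proving (1). *)
Lemma frame_solid_setup {R : realType} (alpha beta gamma : R)
    (V1 V2 V3 : 'rV[R]_3) :
  0 < alpha < pi -> 0 < beta < pi -> 0 < gamma < pi ->
  frame alpha beta gamma V1 V2 V3 ->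
  spherical_setup alpha beta gamma (sphere_trace (<[V2]> + <[V3]>)%VS)
    (sphere_trace (<[V3]> + <[V1]>)%VS) (sphere_trace (<[V1]> + <[V2]>)%VS) ->
  solid_setup alpha beta gamma <[V1]>%VS <[V2]>%VS <[V3]>%VS.
Proof.
move=> /andP[a0 ap] /andP[b0 bp] /andP[g0 gp].
case=> v1 v2 v3 [v23 v31 v12]; split=> //.
- by rewrite !dim_vline !enorm1_neq0.
- by apply: line_angles_vline; rewrite ?ltW.
- by apply: line_angles_vline; rewrite ?ltW.
- by apply: line_angles_vline; rewrite ?ltW.
Qed.

(** * Equivalence of the two questions *)

Theorem proposition3 (R : realType) (angA angB angC alpha beta gamma : R)
    (angA_gt0 : 0 < angA) (angB_gt0 : 0 < angB) (angC_gt0 : 0 < angC)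
    (alpha_gt0 : 0 < alpha) (beta_gt0 : 0 < beta) (gamma_gt0 : 0 < gamma)
    (ang_sum : angA + angB + angC = pi)
    (side_sum : alpha + beta + gamma < 2 * pi)
    (alpha_lt : alpha < beta + gamma)
    (beta_lt : beta < gamma + alpha)
    (gamma_lt : gamma < alpha + beta) :
  [/\ (* the spherical answer depends only on the six numbers *)
      (forall C1 C2 C3 D1 D2 D3 : set 'rV[R]_3,
         spherical_setup alpha beta gamma C1 C2 C3 ->
         spherical_setup alpha beta gamma D1 D2 D3 ->
         (spherical_yes angA angB angC C1 C2 C3 <->
          spherical_yes angA angB angC D1 D2 D3)),
      (* the solid answer depends only on the six numbers *)
      (forall l1 l2 l3 m1 m2 m3 : {vspace 'rV[R]_3},
         solid_setup alpha beta gamma l1 l2 l3 ->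
         solid_setup alpha beta gamma m1 m2 m3 ->
         (solid_yes angA angB angC l1 l2 l3 <->
          solid_yes angA angB angC m1 m2 m3)),
      (* the two answers are the same *)
      (forall (C1 C2 C3 : set 'rV[R]_3) (l1 l2 l3 : {vspace 'rV[R]_3}),
         spherical_setup alpha beta gamma C1 C2 C3 ->
         solid_setup alpha beta gamma l1 l2 l3 ->
         (spherical_yes angA angB angC C1 C2 C3 <->
          solid_yes angA angB angC l1 l2 l3)) &
      (* assertions (1) and (2) are equivalent *)
      ((angA <= pi / 2 -> angB <= pi / 2 -> angC <= pi / 2 ->
        forall C1 C2 C3 : set 'rV[R]_3,
          spherical_setup alpha beta gamma C1 C2 C3 ->
          spherical_yes angA angB angC C1 C2 C3) <->
       (angA <= pi / 2 -> angB <= pi / 2 -> angC <= pi / 2 ->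
        forall l1 l2 l3 : {vspace 'rV[R]_3},
          solid_setup alpha beta gamma l1 l2 l3 ->
          solid_yes angA angB angC l1 l2 l3))].
Proof.
have a_itv : 0 < alpha < pi by apply/andP; split; lra.
have b_itv : 0 < beta < pi by apply/andP; split; lra.
have g_itv : 0 < gamma < pi by apply/andP; split; lra.
have indep V1 V2 V3 := frame_lin_indep _ _ _ V1 V2 V3
  alpha_gt0 beta_gt0 gamma_gt0 side_sum alpha_lt beta_lt gamma_lt.
pose F := @frame R alpha beta gamma.
pose T := @frame_triangle R angA angB angC.
have T_iso V1 V2 V3 W1 W2 W3 : F V1 V2 V3 -> F W1 W2 W3 ->
    T V1 V2 V3 <-> T W1 W2 W3.
  by move=> fV fW; split; apply: frame_triangle_isometric; eassumption.
(* The frame is arbitrary, not tied to the circles: [T_iso] moves the triangle to the frame of the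
   set-up. Independence of the configuration follows from this freedom. *)
have sphericalE C1 C2 C3 V1 V2 V3 :
    spherical_setup alpha beta gamma C1 C2 C3 -> F V1 V2 V3 ->
    spherical_yes angA angB angC C1 C2 C3 <-> T V1 V2 V3.
  move=> /spherical_setup_frame[] // W1 [W2 [W3 [fW -> -> ->]]] fV.
  rewrite (T_iso _ _ _ _ _ _ fV fW); split.
    by apply: spherical_yes_triangle => //; exact: indep fW.
  by apply: triangle_spherical_yes => //; exact: indep fW.
have solidE l1 l2 l3 V1 V2 V3 :
    solid_setup alpha beta gamma l1 l2 l3 -> F V1 V2 V3 ->
    solid_yes angA angB angC l1 l2 l3 <-> T V1 V2 V3.
  move=> /solid_setup_frame[] // W1 [W2 [W3 [fW -> -> ->]]] fV.
  rewrite (T_iso _ _ _ _ _ _ fV fW).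
  exact/solid_yes_triangle/(indep _ _ _ fW).
have same C1 C2 C3 l1 l2 l3 :
    spherical_setup alpha beta gamma C1 C2 C3 ->
    solid_setup alpha beta gamma l1 l2 l3 ->
    spherical_yes angA angB angC C1 C2 C3 <->
    solid_yes angA angB angC l1 l2 l3.
  move=> sC sl; have [] // := spherical_setup_frame _ _ _ _ _ _ _ _ _ sC.
  move=> V1 [V2 [V3 [fV _ _ _]]].
  by rewrite (sphericalE _ _ _ _ _ _ sC fV) (solidE _ _ _ _ _ _ sl fV).
split=> //.
- move=> C1 C2 C3 D1 D2 D3 sC sD.
  have [] // := spherical_setup_frame _ _ _ _ _ _ _ _ _ sC.
  move=> V1 [V2 [V3 [fV _ _ _]]].
  by rewrite (sphericalE _ _ _ _ _ _ sC fV) (sphericalE _ _ _ _ _ _ sD fV).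
(* Both solid answers are compared with the spherical answer on the circles of the first set-up. *)
- move=> l1 l2 l3 m1 m2 m3 sl sm; have [_ _ _ _ sC] := sl.
  by rewrite -(same _ _ _ _ _ _ sC sl) (same _ _ _ _ _ _ sC sm).
split=> yes hA hB hC.
  move=> l1 l2 l3 sl; have [_ _ _ _ sC] := sl.
  exact: (same _ _ _ _ _ _ sC sl).1 (yes hA hB hC _ _ _ sC).
move=> C1 C2 C3 sC.
have [] // := spherical_setup_frame _ _ _ _ _ _ _ _ _ sC.
move=> V1 [V2 [V3 [fV E1 E2 E3]]].
have sl : solid_setup alpha beta gamma <[V1]>%VS <[V2]>%VS <[V3]>%VS.
  by apply: frame_solid_setup => //; rewrite -E1 -E2 -E3.
exact: (same _ _ _ _ _ _ sC sl).2 (yes hA hB hC _ _ _ sl).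
Qed.
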